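(* Let $M\in\mathbb{N}$ be odd and $n=\frac{M+1}{2}$. The extended Gramian closure $\mathcal{C}:\mathcal{R}\to\mathbb{R}$ for odd $M$, $$u_{2n}=\mathcal{C}(u_0,\dots,u_{2n-1})=u_{n+1,2n-1}^{T}G_{n-2}^{-1}u_{n-1,2n-3}+\chi\,\frac{\sigma_{n-1,n}^2}{\sigma_{n-1,n-1}},$$ with the choice $\chi=\frac{n+1}{2n}$ is gauge-invariant.
   Context: Realizable moments: $\mathcal{R}\subset\mathbb{R}^{M+1}$ is the set of vectors $(u_0,\dots,u_M)$ with $u_k=\int_{\mathbb{R}}c^kf(c)\,dc$ for some measurable $f:\mathbb{R}\to[0,\infty)$, not almost everywhere zero, with finite moments up to order $M$. Gramian matrix: $G_k=(u_{i+j})_{i,j=0,\dots,k}\in\mathbb{R}^{(k+1)\times(k+1)}$; it is symmetric positive definite for $2k\le M$ and realizable moments. For $k\le l$, $u_{k,l}=(u_k,u_{k+1},\dots,u_l)^T$. Terms involving the empty matrix $G_{-1}$ are zero. For $k\ge0$, $$\sigma_{k,k}=u_{2k}-u_{k,2k-1}^TG_{k-1}^{-1}u_{k,2k-1},\qquad \sigma_{k,k+1}=u_{2k+1}-u_{k+1,2k}^TG_{k-1}^{-1}u_{k,2k-1}.$$ Gauge transformation: for $\rho,\theta>0$ and $v\in\mathbb{R}$, the transformed moments are $$\widetilde u_k=\frac{1}{\rho\,\theta^{k/2}}\sum_{j=0}^{k}\binom{k}{j}v^ju_{k-j},\qquad k=0,\dots,M+1$$ (the moments of $g(\widetilde c)=\rho^{-1}\theta^{1/2}f(\theta^{1/2}\widetilde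 c-v)$; in particular $\mathcal{R}$ is mapped to itself). Gauge-invariance: $\mathcal{C}$ is gauge-invariant if for all $\rho,\theta>0$, $v\in\mathbb{R}$, all $(u_0,\dots,u_M)\in\mathcal{R}$ and all $u_{M+1}\in\mathbb{R}$, $$\widetilde u_{M+1}=\mathcal{C}(\widetilde u_0,\dots,\widetilde u_M)\iff u_{M+1}=\mathcal{C}(u_0,\dots,u_M).$$ *)

(* Defs.v *)
From HB Require Import structures.
From mathcomp Require Import all_boot all_order all_algebra.
From mathcomp Require Import all_classical all_reals all_analysis.

Set Implicit Arguments.
Unset Strict Implicit.
Unset Printing Implicit Defensive.

Import Order.TTheory GRing.Theory Num.Theory.
Import numFieldNormedType.Exports.

Local Open Scope classical_set_scope.
Local Open Scope ring_scope.

(* Moment vectors in R^(M+1) are (M.+1)-tuples, so that u`_k is the moment of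
   order k. *)
Definition realizable (R : realType) (M : nat) : set (M.+1.-tuple R) :=
  [set u : M.+1.-tuple R | exists f : R -> R,
    [/\ measurable_fun setT f,
        forall c, 0 <= f c,
        ~ {ae (@lebesgue_measure R), forall c, f c = 0} &
        forall k : nat, (k <= M)%N ->
          (@lebesgue_measure R).-integrable setT
            (fun c => (c ^+ k * f c)%:E) /\
          u`_k = \int[lebesgue_measure]_c (c ^+ k * f c)]].

(* [gram u m] is G_(m-1), and [moments u k m] is the column
   (u_k, ..., u_(k+m-1)): both are indexed by their size, so that G_(-1) and
   the empty columns are the case m = 0. *)
Definition gram (R : realType) (u : seq R) (m : nat) : 'M[R]_m :=
  \matrix_(i, j) u`_(i + j).

Definition moments (R : realType) (u : seq R) (k m : nat) : 'cV[R]_m :=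
  \col_i u`_(k + i).

(* u_(k, k+m-1)^T G_(m-1)^-1 u_(l, l+m-1), which is 0 for m = 0 *)
Definition gram_form (R : realType) (u : seq R) (k l m : nat) : R :=
  ((moments u k m)^T *m invmx (gram u m) *m moments u l m) 0 0.

(* sigma_(k,k) and sigma_(k,k+1) *)
Definition sigma_diag (R : realType) (u : seq R) (k : nat) : R :=
  u`_(2 * k) - gram_form u k k k.

Definition sigma_next (R : realType) (u : seq R) (k : nat) : R :=
  u`_(2 * k + 1) - gram_form u k.+1 k k.

Definition gauge (R : realType) (rho theta v : R) (m : nat)
    (u : m.-tuple R) : m.-tuple R :=
  [tuple (rho * theta `^ (k%:R / 2))^-1 *
         \sum_(0 <= j < k.+1) 'C(k, j)%:R * v ^+ j * u`_(k - j) | k < m].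

(* A closure is a total function of which only the values on realizable moment
   vectors are relevant; [gauge] preserves realizability. *)
Definition gauge_invariant (R : realType) (M : nat)
    (C : M.+1.-tuple R -> R) : Prop :=
  forall (rho theta v : R), 0 < rho -> 0 < theta ->
  forall (u : M.+1.-tuple R), realizable u ->
  forall w : R,
    (gauge rho theta v [tuple of rcons u w])`_M.+1 = C (gauge rho theta v u)
    <-> w = C u.

Definition extended_gramian_closure_odd (R : realType) (M : nat) (chi : R)
    (u : M.+1.-tuple R) : R :=
  let n := M.+1./2 in
  gram_form u n.+1 n.-1 n.-1
  + chi * (sigma_next u n.-1 ^+ 2 / sigma_diag u n.-1).

(* Main.v *)
(* Let L be the linear functional on polynomials with L(X^k) = u_k, let p be
   the monic orthogonal polynomial of degree m = n - 1, and put
   A = L(X^m p), B = L(X^(m+1) p), D = L(X^(m+2) p).  Then sigma_(m,m) = A > 0,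
   sigma_(m,m+1) = B, and the closure says D A = chi B^2.  A gauge
   transformation amounts to the substitution X -> (X + v) / sqrt theta, which
   carries orthogonal polynomials to orthogonal polynomials, so up to powers of
   sqrt theta and rho it replaces B by B + (m+1) v A and D by
   D + (m+2) v B + (m+2)(m+1)/2 v^2 A.  The terms in v cancel in D A - chi B^2
   exactly when chi = (m+2) / (2 (m+1)). *)
Require Import Defs.
From HB Require Import structures.
From mathcomp Require Import all_boot all_order all_algebra.
From mathcomp Require Import all_classical all_reals all_analysis.
From mathcomp Require Import ring lra zify.

Set Implicit Arguments.
Unset Strict Implicit.
Unset Printing Implicit Defensive.

Import Order.TTheory GRing.Theory Num.Theory.

Local Open Scope ring_scope.

(** * The moment functional L, its orthogonal polynomials, and Gramian forms *)

Section MomentFunctional.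
Variable R : realType.
Implicit Types (u : seq R) (p q : {poly R}).

(** The functional L, made total by dropping the coefficients that have no moment in [u]. *)
Definition moment_fun u p : R := \sum_(i < size u) p`_i * u`_i.

Lemma moment_fun_is_linear u : linear_for *%R (moment_fun u).
Proof.
move=> a p q; rewrite /moment_fun mulr_sumr -big_split /=.
by apply: eq_bigr => i _; rewrite coefD coefZ mulrDl mulrA.
Qed.

HB.instance Definition _ u :=
  GRing.isLinear.Build R {poly R} R *%R (moment_fun u)
    (moment_fun_is_linear u).

Lemma moment_funZ u c p : moment_fun u (c *: p) = c * moment_fun u p.
Proof. exact: linearZ. Qed.

Lemma moment_funE u p n : (size p <= n)%N -> (n <= size u)%N ->
  moment_fun u p = \sum_(i < n) p`_i * u`_i.
Proof.
move=> pn nu; rewrite /moment_fun.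
rewrite [RHS](big_ord_widen (size u) (fun i => p`_i * u`_i)) //.
rewrite [RHS]big_mkcond /=; apply: eq_bigr => i _.
by case: ltnP => // ni; rewrite nth_default ?mul0r // (leq_trans pn).
Qed.

Lemma moment_funXn u k : (k < size u)%N -> moment_fun u 'X^k = u`_k.
Proof.
move=> ku; rewrite /moment_fun (bigD1 (Ordinal ku)) //= coefXn eqxx mul1r.
by rewrite big1 ?addr0 // => i ik; rewrite coefXn [_ == _](negPf ik) mul0r.
Qed.

Lemma eq_moment_fun u u' p :
  (size p <= size u)%N -> (size p <= size u')%N ->
  (forall i, (i < size p)%N -> u`_i = u'`_i) ->
  moment_fun u p = moment_fun u' p.
Proof.
move=> pu pu' uu'.
rewrite (moment_funE (leqnn _) pu) (moment_funE (leqnn _) pu').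
by apply: eq_bigr => i _; rewrite uu'.
Qed.

Lemma moment_fun_mul u p q :
  moment_fun u (p * q) = \sum_(i < size p) p`_i * moment_fun u ('X^i * q).
Proof.
rewrite -[in LHS](coefK p) poly_def mulr_suml raddf_sum /=.
by apply: eq_bigr => i _; rewrite -scalerAl moment_funZ.
Qed.

(** As long as [u] contains the moments up to order 2m, this is positive definiteness of G_m, the
    Gramian of size m + 1. *)
Definition moment_pos u m := forall p, p != 0 -> (size p <= m.+1)%N ->
  0 < moment_fun u (p * p).

Definition orthogonal_to_lower u m p :=
  forall i, (i < m)%N -> moment_fun u ('X^i * p) = 0.

Lemma orthogonal_to_lowerP u m p q : orthogonal_to_lower u m p ->
  (size q <= m)%N -> moment_fun u (q * p) = 0.
Proof.
move=> ortho qm; rewrite moment_fun_mul big1 // => i _.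
by rewrite ortho ?mulr0 // (leq_trans (ltn_ord i)).
Qed.

Lemma size_monic_subXn m p : p \is monic -> size p = m.+1 ->
  (size (p - 'X^m)%R <= m)%N.
Proof.
move=> /monicP + sp; rewrite lead_coefE sp /= => p1.
apply/leq_sizeP => j; rewrite leq_eqVlt => /predU1P[<-|mj].
  by rewrite coefB coefXn eqxx p1 subrr.
by rewrite coefB coefXn nth_default ?sp // gtn_eqF // subrr.
Qed.

(** The two sides differ by L((p - X^m) p), and p - X^m has degree below m. Thus A is the value of L
    on a square, and positivity applies to it. *)
Lemma moment_fun_sqr u m p : p \is monic -> size p = m.+1 ->
  orthogonal_to_lower u m p ->
  moment_fun u (p * p) = moment_fun u ('X^m * p).
Proof.
move=> mp sp ortho; rewrite -[X in X * p](subrK 'X^m) mulrDl raddfD /=.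
by rewrite (orthogonal_to_lowerP ortho) ?add0r // size_monic_subXn.
Qed.

Lemma moments_dot u k m (c : 'cV[R]_m) : (k + m <= size u)%N ->
  ((moments u k m)^T *m c) 0 0
  = moment_fun u ('X^k * \sum_(j < m) c j 0 *: 'X^j).
Proof.
move=> km; rewrite mxE mulr_sumr raddf_sum /=; apply: eq_bigr => j _.
rewrite -scalerAr moment_funZ /= -exprD moment_funXn ?mxE 1?mulrC //.
by rewrite (leq_trans _ km) // ltn_add2l.
Qed.

Lemma gram_mul u m (c : 'cV[R]_m) i : (m + m <= (size u).+1)%N ->
  (gram u m *m c) i 0 = moment_fun u ('X^i * \sum_(j < m) c j 0 *: 'X^j).
Proof.
move=> mm; rewrite -moments_dot; last by have := ltn_ord i; lia.
by rewrite !mxE; apply: eq_bigr => j _; rewrite !mxE.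
Qed.

(** A kernel vector is the coefficient vector of some p of degree below m with L(X^i p) = 0 for all
    i < m. Then L(p p) = 0, which forces p = 0. *)
Lemma gram_unit u m : (m + m <= (size u).+1)%N -> moment_pos u m ->
  gram u m \in unitmx.
Proof.
move=> mm pos; rewrite -unitmx_tr -row_free_unit -kermx_eq0.
apply/rowV0P => x /sub_kermxP x0.
pose p := \sum_(j < m) x^T j 0 *: 'X^j : {poly R}.
have pE j : p`_j = if insub j is Some i then x 0 i else 0.
  rewrite /p coef_sum; case: insubP => [i jm <-|].
    rewrite (bigD1 i) //= coefZ coefXn eqxx mxE mulr1 big1 ?addr0 // => k ki.
    by rewrite coefZ coefXn eq_sym [_ == _](negPf ki) mulr0.
  move=> jm; rewrite big1 // => k _; rewrite coefZ coefXn.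
  by rewrite gtn_eqF ?mulr0 // (leq_trans (ltn_ord k)) // leqNgt.
have sp : (size p <= m)%N.
  by apply/leq_sizeP => j mj; rewrite pE; case: insubP => // i; lia.
case: (eqVneq p 0) => [p0|/pos /(_ (leqW sp))].
  apply/rowP => i; rewrite mxE; have := pE i; rewrite p0 coef0.
  by case: insubP => [k _ /val_inj ->|] //; rewrite ltn_ord.
suff -> : moment_fun u (p * p) = 0 by rewrite ltxx.
rewrite moment_fun_mul big1 // => i _.
have im : (i < m)%N by rewrite (leq_trans (ltn_ord i)).
rewrite -(gram_mul x^T (Ordinal im) mm).
by rewrite -[gram u m]trmxK -trmx_mul x0 !mxE mulr0.
Qed.

(** Subtract from X^m its projection r onto lower degrees; the coefficients of r solve the normal
    equations with matrix G_(m-1). *)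
Lemma exists_orthogonal u m : (m + m < size u)%N -> moment_pos u m ->
  exists p, [/\ p \is monic, size p = m.+1 & orthogonal_to_lower u m p].
Proof.
move=> mm pos.
have Gu : gram u m \in unitmx by apply: gram_unit => //; lia.
pose c := invmx (gram u m) *m moments u m m.
pose r := \sum_(j < m) c j 0 *: 'X^j : {poly R}.
have sr : (size (- r)%R < size ('X^m : {poly R}))%N.
  rewrite size_polyXn ltnS size_polyN; apply: (leq_trans (size_sum _ _ _)).
  apply/bigmax_leqP => j _; apply: (leq_trans (size_scale_leq _ _)).
  by rewrite size_polyXn.
exists ('X^m - r); split.
- by rewrite monicE lead_coefDl // lead_coefXn.
- by rewrite size_polyDl // size_polyXn.
move=> i im; rewrite mulrBr raddfB /=.
rewrite -(gram_mul c (Ordinal im)) ?mulmxA; last lia.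
rewrite (mulmxV Gu) mul1mx mxE -exprD moment_funXn 1?[(m + i)%N]addnC ?subrr //.
by lia.
Qed.

(** By orthogonality, the coefficient vector [c] of X^m - p solves G_(m-1) c = (u_m, ..., u_(2m-1)),
    so the form equals L(X^k (X^m - p)). *)
Lemma gram_form_orthogonal u k m p : (m + m < size u)%N -> (k + m < size u)%N ->
  moment_pos u m -> p \is monic -> size p = m.+1 ->
  orthogonal_to_lower u m p ->
  gram_form u k m m = u`_(k + m) - moment_fun u ('X^k * p).
Proof.
move=> mm km pos mp sp ortho.
have Gu : gram u m \in unitmx by apply: gram_unit => //; lia.
pose c : 'cV[R]_m := \col_i - p`_i.
have cE : \sum_(j < m) c j 0 *: 'X^j = 'X^m - p.
  have := size_monic_subXn mp sp; set r := p - _ => sr.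
  rewrite -opprB -/r -[in RHS](coefK r) poly_def -sumrN.
  rewrite [RHS](big_ord_widen m (fun i => - (r`_i *: 'X^i))) //.
  rewrite [RHS]big_mkcond /=.
  apply: eq_bigr => j _; rewrite mxE.
  have -> : p`_j = r`_j by rewrite coefB coefXn ltn_eqF // subr0.
  case: ltnP => [_|jr]; rewrite ?scaleNr //.
  by rewrite nth_default // scale0r oppr0.
have cG : moments u m m = gram u m *m c.
  apply/colP => i; rewrite gram_mul ?cE; last lia.
  rewrite mulrBr raddfB /= ortho // subr0 -exprD moment_funXn ?mxE 1?addnC //.
  by have := ltn_ord i; lia.
rewrite /gram_form [in X in _ *m X]cG -mulmxA (mulmxA (invmx _)) mulVmx //.
rewrite mul1mx moments_dot ?cE; last exact: ltnW.
by rewrite mulrBr raddfB /= -exprD moment_funXn.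
Qed.

(** Expressing the Gramian forms through p makes u_(2m+2) cancel and leaves D = chi B^2 / A; since A
    = L(p p) > 0, the denominator can be cleared. *)
Lemma closure_orthogonal u m p chi : size u = (m + m).+3%N -> moment_pos u m ->
  p \is monic -> size p = m.+1 -> orthogonal_to_lower u m p ->
  u`_(m + m).+2 =
    gram_form u m.+2 m m + chi * (sigma_next u m ^+ 2 / sigma_diag u m)
  <-> moment_fun u ('X^(m.+2) * p) * moment_fun u ('X^m * p)
      = chi * moment_fun u ('X^(m.+1) * p) ^+ 2.
Proof.
move=> su pos mp sp ortho.
have A0 : 0 < moment_fun u ('X^m * p).
  rewrite -moment_fun_sqr //; apply: pos; last by rewrite sp.
  exact: monic_neq0.
rewrite /sigma_next /sigma_diag.
rewrite !(gram_form_orthogonal _ _ pos mp sp ortho) ?su; try lia.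
have -> : (2 * m = m + m)%N by lia.
have -> : (m + m + 1 = m.+1 + m)%N by lia.
have -> : ((m + m).+2 = m.+2 + m)%N by lia.
rewrite !subKr; set D := moment_fun u ('X^(m.+2) * p).
set A := moment_fun u ('X^m * p) in A0 *; set B := moment_fun u _.
have An0 : A != 0 by rewrite gt_eqF.
split=> [E|E].
  have -> : D = chi * (B ^+ 2 / A).
    by apply/eqP; rewrite -subr_eq0; apply/eqP; lra.
  by field.
have -> : chi * (B ^+ 2 / A) = D by rewrite mulrA -E mulfK.
by rewrite subrK.
Qed.

Lemma moment_fun_shift u m p v k d :
  orthogonal_to_lower u m p -> (k <= m + d)%N ->
  moment_fun u (('X + v%:P) ^+ k * p) =
  \sum_(i < d.+1) 'C(k, i)%:R * v ^+ i * moment_fun u ('X^(k - i) * p).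
Proof.
move=> ortho km; rewrite exprDn mulr_suml raddf_sum /=.
pose F i := 'C(k, i)%:R * v ^+ i * moment_fun u ('X^(k - i) * p).
rewrite (eq_bigr (fun i : 'I_k.+1 => F i)); last first.
  move=> i _; rewrite -mulrnAr -rmorphXn -rmorphMn /= [_ * _%:P]mulrC.
  by rewrite mul_polyC -scalerAl moment_funZ /= -mulr_natl.
(* Over a common range, the surplus terms vanish: for d < i <= k by orthogonality, as k - i < m, and
   for k < i <= d because the binomial coefficient is 0. *)
rewrite (big_ord_widen (k + d).+1 F) ?[RHS](big_ord_widen (k + d).+1 F);
  try lia.
rewrite big_mkcond [RHS]big_mkcond /=; apply: eq_bigr => i _.
case: ltnP => ik; case: ltnP => id //.
  by rewrite /F ortho ?mulr0 //; lia.
by rewrite /F bin_small ?mul0r.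
Qed.

End MomentFunctional.

Lemma eq_gram_form (R : realType) (u u' : seq R) k l m N :
  (forall i, (i < N)%N -> u`_i = u'`_i) ->
  (k + m <= N)%N -> (l + m <= N)%N -> (m + m <= N)%N ->
  gram_form u k l m = gram_form u' k l m.
Proof.
move=> uu' kN lN mN; rewrite /gram_form; congr ((_ *m invmx _ *m _) 0 0).
- by apply/rowP => i; rewrite !mxE uu' //; have := ltn_ord i; lia.
- apply/matrixP => i j; rewrite !mxE uu' //.
  by have := ltn_ord i; have := ltn_ord j; lia.
- by apply/colP => i; rewrite !mxE uu' //; have := ltn_ord i; lia.
Qed.

(** The closure depends only on u_0, ..., u_(2m+1), so it can be evaluated on the vector extended by
    u_(2m+2), where L(X^(m+2) p) makes sense. *)
Lemma eq_extended_gramian (R : realType) (u u' : seq R) m (chi : R) :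
  (forall i, (i < (m + m).+2)%N -> u`_i = u'`_i) ->
  gram_form u m.+2 m m + chi * (sigma_next u m ^+ 2 / sigma_diag u m) =
  gram_form u' m.+2 m m + chi * (sigma_next u' m ^+ 2 / sigma_diag u' m).
Proof.
move=> uu'; rewrite /sigma_next /sigma_diag !uu'; try lia.
by rewrite !(eq_gram_form uu'); try lia.
Qed.

(** * The gauge transformation as an affine substitution in L *)

Section Gauge.
Variable R : realType.

Lemma nth_gauge (rho theta v : R) m (u : m.-tuple R) i : (i < m)%N ->
  (gauge rho theta v u)`_i = (rho * theta `^ (i%:R / 2))^-1 *
    \sum_(0 <= j < i.+1) 'C(i, j)%:R * v ^+ j * u`_(i - j).
Proof. by move=> im; rewrite (nth_mktuple _ _ (Ordinal im)). Qed.

(** On a monomial X^i, the binomial expansion of ((X + v) / sqrt theta)^i is exactly the sum that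
    defines [gauge]. *)
Lemma moment_fun_gauge (rho theta v : R) m (u : m.-tuple R) (p : {poly R}) :
  0 <= theta -> (size p <= m)%N ->
  moment_fun (gauge rho theta v u) p =
  rho^-1 * moment_fun u (p \Po ((Num.sqrt theta)^-1 *: ('X + v%:P))).
Proof.
move=> th0 pm; rewrite comp_polyE raddf_sum mulr_sumr /=.
rewrite (moment_funE (leqnn _)) ?size_tuple ?card_ord //.
apply: eq_bigr => -[i ip] _ /=; have im := leq_trans ip pm.
rewrite nth_gauge // moment_funZ /= exprZn moment_funZ /= exprDn raddf_sum.
rewrite big_mkord /=.
rewrite [X in _ = _ * (_ * (_ * X))](eq_bigr
  (fun j : 'I_i.+1 => 'C(i, j)%:R * v ^+ j * u`_(i - j)))
  => [|j _]; last first.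
  rewrite -mulrnAr -rmorphXn -rmorphMn /= mulrC mul_polyC moment_funZ /=.
  by rewrite -mulr_natl moment_funXn // size_tuple; lia.
have -> : theta `^ (i%:R / 2) = Num.sqrt theta ^+ i.
  by rewrite mulrC powRrM powR12_sqrt // powR_mulrn ?sqrtr_ge0.
by rewrite invfM exprVn; ring.
Qed.

Lemma moment_pos_rcons k m (u : m.-tuple R) w : (k + k < m)%N ->
  moment_pos u k -> moment_pos [tuple of rcons u w] k.
Proof.
move=> km pos p p0 pk; rewrite -(eq_moment_fun (u := u)); first exact: pos.
- apply: (leq_trans (size_polyMleq _ _)); rewrite size_tuple; lia.
- apply: (leq_trans (size_polyMleq _ _)); rewrite size_tuple; lia.
move=> i ip; rewrite nth_rcons size_tuple ifT //.
by apply: (leq_trans ip); apply: (leq_trans (size_polyMleq _ _)); lia.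
Qed.

Lemma gauge_rcons (rho theta v : R) m (u : m.-tuple R) w i : (i < m)%N ->
  (gauge rho theta v [tuple of rcons u w])`_i = (gauge rho theta v u)`_i.
Proof.
move=> im; rewrite (nth_gauge _ _ _ _ im) nth_gauge /= ?(leqW im) //.
congr (_ * _); rewrite !big_mkord; apply: eq_bigr => j _; congr (_ * _).
by rewrite nth_rcons size_tuple ifT //; lia.
Qed.

(** Composition with a polynomial of degree one sends squares to squares and preserves degree and
    non-vanishing. *)
Lemma moment_pos_gauge (rho theta v : R) k m (u : m.-tuple R) :
  0 < rho -> 0 < theta -> (k + k < m)%N -> moment_pos u k ->
  moment_pos (gauge rho theta v u) k.
Proof.
move=> rho0 th0 km pos p p0 pk.
have s0 : Num.sqrt theta != 0 by rewrite sqrtr_eq0 -ltNge.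
set l := (Num.sqrt theta)^-1 *: ('X + v%:P).
have sl : size l = 2 by rewrite size_scale ?invr_eq0 // size_XaddC.
rewrite moment_fun_gauge ?(ltW th0) //; last first.
  by apply: (leq_trans (size_polyMleq _ _)); lia.
rewrite -/l comp_polyM mulr_gt0 ?invr_gt0 //; apply: pos.
  by rewrite -size_poly_eq0 size_comp_poly2 // size_poly_eq0.
by rewrite size_comp_poly2.
Qed.

(* The orthogonal polynomial of the transformed moments: it pulls back along
   x |-> (x + v) / s to s^-m p. *)
Definition gauge_poly (s v : R) m (p : {poly R}) : {poly R} :=
  s ^- m *: (p \Po (s *: 'X - v%:P)).

Lemma gauge_poly_comp (s v : R) m (p : {poly R}) : s != 0 ->
  gauge_poly s v m p \Po (s^-1 *: ('X + v%:P)) = s ^- m *: p.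
Proof.
move=> s0; rewrite /gauge_poly comp_polyZ -comp_polyA comp_polyB comp_polyZ.
by rewrite comp_polyX comp_polyC scalerA divff // scale1r addrK comp_polyXr.
Qed.

Lemma size_gauge_lin (s v : R) : s != 0 -> size (s *: 'X - v%:P)%R = 2%N.
Proof.
move=> s0; rewrite size_polyDl ?size_polyN size_scale ?size_polyX //.
by rewrite (leq_ltn_trans (size_polyC_leq1 _)).
Qed.

Lemma size_gauge_poly (s v : R) m (p : {poly R}) : s != 0 ->
  size (gauge_poly s v m p) = size p.
Proof.
move=> s0; rewrite size_scale ?invr_eq0 ?expf_neq0 // size_comp_poly2 //.
exact: size_gauge_lin.
Qed.

Lemma gauge_poly_monic (s v : R) m (p : {poly R}) : s != 0 -> p \is monic ->
  size p = m.+1 -> gauge_poly s v m p \is monic.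
Proof.
move=> s0 /monicP mp sp; apply/monicP.
rewrite lead_coefZ lead_coef_comp ?size_gauge_lin // mp sp /= mul1r.
rewrite lead_coefDl ?lead_coefZ ?lead_coefX ?mulr1 ?mulVf ?expf_neq0 //.
rewrite size_polyN size_scale // size_polyX.
by rewrite (leq_ltn_trans (size_polyC_leq1 _)).
Qed.

(** With s = sqrt theta, the substitution turns X^k into s^-k (X + v)^k and [gauge_poly] into s^-m
    p. *)
Lemma moment_fun_gauge_poly (rho theta v : R) k m N (u : N.-tuple R)
    (p : {poly R}) :
  0 < theta -> size p = m.+1 -> (k + m < N)%N ->
  moment_fun (gauge rho theta v u)
    ('X^k * gauge_poly (Num.sqrt theta) v m p)
  = rho^-1 * Num.sqrt theta ^- (k + m) * moment_fun u (('X + v%:P) ^+ k * p).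
Proof.
move=> th0 sp km.
have s0 : Num.sqrt theta != 0 by rewrite sqrtr_eq0 -ltNge.
rewrite moment_fun_gauge ?(ltW th0) //; last first.
  apply: (leq_trans (size_polyMleq _ _)).
  by rewrite size_gauge_poly // size_polyXn sp; lia.
rewrite comp_polyM gauge_poly_comp // comp_Xn_poly exprZn -scalerAr -scalerAl.
by rewrite scalerA moment_funZ /= mulrA exprD invfM exprVn; congr (_ * _); ring.
Qed.

Lemma closure_condition_gauge (rho theta v : R) m N (u : N.-tuple R)
    (p : {poly R}) :
  0 < rho -> 0 < theta -> ((m + m).+2 < N)%N -> size p = m.+1 ->
  orthogonal_to_lower u m p ->
  let chi : R := m.+2%:R / (2 * m.+1)%:R in
  let pt := gauge_poly (Num.sqrt theta) v m p in
  let L := moment_fun (gauge rho theta v u) in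
  L ('X^(m.+2) * pt) * L ('X^m * pt) = chi * L ('X^(m.+1) * pt) ^+ 2
  <-> moment_fun u ('X^(m.+2) * p) * moment_fun u ('X^m * p)
      = chi * moment_fun u ('X^(m.+1) * p) ^+ 2.
Proof.
move=> rho0 th0 mN sp ortho chi pt L.
have s0 : Num.sqrt theta != 0 by rewrite sqrtr_eq0 -ltNge.
rewrite /L /pt !moment_fun_gauge_poly //; try lia.
(* Orthogonality leaves three, two and one terms of the expansions of (X + v)^(m+2), (X + v)^(m+1)
   and (X + v)^m. *)
rewrite (@moment_fun_shift _ _ _ _ v m.+2 2 ortho); last lia.
rewrite (@moment_fun_shift _ _ _ _ v m.+1 1 ortho); last lia.
rewrite (@moment_fun_shift _ _ _ _ v m 0 ortho); last lia.
rewrite !big_ord_recl !big_ord0 /= !bin0 !bin1 !subn0 !subn1 subn2 /bump /=.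
set D := moment_fun u ('X^(m.+2) * p); set A := moment_fun u ('X^m * p).
set B := moment_fun u _; set s := Num.sqrt theta in s0 *.
have C2 : 'C(m.+2, 2)%:R = m.+2%:R * m.+1%:R / 2 :> R.
  apply: (@mulIf _ 2); rewrite ?divfK ?pnatr_eq0 //.
  by rewrite -!natrM mulnC -mul_bin_diag bin1.
(* The shifted B is scaled by [a], the shifted D by [a / s] and A by [a * s], so both sides of the
   condition scale by [a ^+ 2]. *)
set a := rho^-1 * s ^- (m.+1 + m).
have aD : rho^-1 * s ^- (m.+2 + m) = a / s.
  by rewrite /a (addSn m.+1) exprS invfM mulrCA [RHS]mulrC.
have aA : rho^-1 * s ^- (m + m) = a * s.
  rewrite /a addSn exprS invfM; field.
  by rewrite (expf_neq0 _ s0) s0 (gt_eqF rho0).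
have a0 : a ^+ 2 != 0.
  by rewrite expf_neq0 // mulf_neq0 ?invr_eq0 ?expf_neq0 // gt_eqF.
have x0 : m.+1%:R != 0 :> R by rewrite pnatr_eq0.
rewrite C2 aD aA /chi natrM -[m.+2]addn1 [(m.+1 + 1)%:R]natrD.
move: (m.+1%:R : R) x0 => x x0; set c := (x + 1) / (2 * x).
(* With x = m + 1, the terms linear and quadratic in v cancel because 2 c x = x + 1 and c x^2 = x (x
   + 1) / 2. *)
match goal with |- (?l = ?r) <-> _ =>
  have key : l - r = a ^+ 2 * (D * A - c * B ^+ 2)
    by rewrite /c; field; rewrite s0 x0
end.
split=> E; last by apply/eqP; rewrite -subr_eq0 key E subrr mulr0.
move: key; rewrite E subrr => /esym/eqP.
by rewrite mulf_eq0 (negPf a0) subr_eq0 => /eqP.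
Qed.

End Gauge.

(** * Positivity of L for realizable moments *)

Section Realizable.
Variable R : realType.
Notation mu := (@lebesgue_measure R).

Lemma moment_fun_integral M (u : M.+1.-tuple R) (f : R -> R) (p : {poly R}) :
  (forall k, (k <= M)%N ->
     mu.-integrable setT (fun c => (c ^+ k * f c)%:E) /\
     u`_k = \int[mu]_c (c ^+ k * f c)) ->
  (size p <= M.+1)%N ->
  mu.-integrable setT (fun c => (p.[c] * f c)%:E) /\
  moment_fun u p = \int[mu]_c (p.[c] * f c).
Proof.
move=> H sp.
have -> : moment_fun u p = \sum_(i < size p) p`_i * u`_i.
  by apply: moment_funE; rewrite ?size_tuple.
under eq_fun do rewrite horner_coef.
under eq_Rintegral do rewrite horner_coef.
move: sp; elim: (size p) => [|k IH] kM.
  split; first by under eq_fun do rewrite big_ord0 mul0r; exact: integrable0.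
  rewrite big_ord0; under eq_Rintegral do rewrite big_ord0 mul0r.
  by rewrite Rintegral_cst // mul0r.
have [IH1 IH2] := IH (ltnW kM); have [H1 H2] := H k kM.
have H3 : mu.-integrable setT (EFin \o (fun c => p`_k * (c ^+ k * f c))).
  exact: (integrableZl measurableT p`_k H1).
split.
  under eq_fun do rewrite big_ord_recr /= mulrDl -mulrA EFinD.
  exact: integrableD.
under eq_Rintegral do rewrite big_ord_recr /= mulrDl -mulrA.
by rewrite big_ord_recr RintegralD //= IH2 RintegralZl // H2.
Qed.

(** Induction on the size: each root splits off a linear factor, which vanishes only on a null
    singleton. *)
Lemma ae_horner_neq0 (p : {poly R}) : p != 0 ->
  {ae mu, forall c, p.[c] != 0}.
Proof.
have [n] := ubnP (size p); elim: n p => // n IH p sp p0.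
have [[a ra]|nr] := pselect (exists a, root p a); last first.
  by apply: aeW => c; apply/negP => pc; apply: nr; exists c.
have /factor_theorem [q pE] := ra.
have q0 : q != 0 by apply: contra_neq p0 => q0; rewrite pE q0 mul0r.
have sq : (size q < n)%N.
  by move: sp; rewrite pE size_Mmonic ?monicXsubC // size_XsubC addn2.
have ae_a : {ae mu, forall c, c != a}.
  exists [set a]%classic; split => //; first exact: lebesgue_measure_set1.
  by move=> c /= /negP; rewrite negbK => /eqP.
apply: (@filterS2 _ _ (ae_filter_ringOfSetsType mu) _ _ _ _
  (IH q sq q0) ae_a) => c qc ca.
by rewrite pE hornerM hornerXsubC mulf_neq0 // subr_eq0.
Qed.

(** L(p p) is the integral of p^2 f >= 0. Were it zero, p^2 f would vanish almost everywhere, and so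
    would f, since p is nonzero almost everywhere. *)
Lemma realizable_moment_pos M (u : M.+1.-tuple R) m : (m + m <= M)%N ->
  realizable u -> moment_pos u m.
Proof.
move=> mM [f [mf f0 fn0 H]] p p0 pm.
have [I ->] : mu.-integrable setT (fun c => ((p * p).[c] * f c)%:E) /\
    moment_fun u (p * p) = \int[mu]_c ((p * p).[c] * f c).
  apply: moment_fun_integral => //.
  by apply: (leq_trans (size_polyMleq _ _)); lia.
have g0 c : 0 <= (p * p).[c] * f c.
  by rewrite hornerM -expr2 mulr_ge0 // sqr_ge0.
rewrite lt_neqAle Rintegral_ge0 // andbT eq_sym; apply/eqP => J0; apply: fn0.
have ae0 : ae_eq mu setT (fun c => ((p * p).[c] * f c)%:E) (cst 0%E).
  apply/ae_eq_integral_abs => //; first exact: measurable_int I.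
  under eq_integral do rewrite /= ger0_norm //.
  rewrite -(fineK (integrable_fin_num measurableT I)).
  by congr EFin.
apply: (@filterS2 _ _ (ae_filter_ringOfSetsType mu) _ _ _ _
  (ae_horner_neq0 p0) ae0) => c pc /(_ Logic.I) [].
by move=> /eqP; rewrite hornerM !mulf_eq0 (negPf pc) /= => /eqP.
Qed.

End Realizable.

Theorem theorem7p2 (R : realType) (M n : nat) (hM : odd M)
    (hn : n = M.+1./2) :
  gauge_invariant
    (@extended_gramian_closure_odd R M (n.+1%:R / (2 * n)%:R)).
Proof.
move=> rho theta v rho0 th0 u ru w.
have [m nm Mm] : exists2 m, n = m.+1 & M = (m + m).+1.
  by exists n.-1; move: hM hn; lia.
subst M; set U := [tuple of rcons u w]; set Ug := gauge _ _ _ U.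
rewrite /extended_gramian_closure_odd -hn nm [m.+1.-1]/=.
have uU i : (i < (m + m).+2)%N -> u`_i = U`_i.
  by move=> im; rewrite nth_rcons size_tuple im.
have posu : moment_pos u m by apply: realizable_moment_pos ru.
have posU : moment_pos U m by apply: moment_pos_rcons => //; lia.
(* The polynomial is taken for the extended vector [U], since L(X^(m+2) p) involves the moment [w]
   of order 2m + 2. *)
have [p [mp sp ortho]] : exists p, [/\ p \is monic, size p = m.+1
    & orthogonal_to_lower U m p].
  by apply: exists_orthogonal; rewrite // size_tuple; lia.
have s0 : Num.sqrt theta != 0 by rewrite sqrtr_eq0 -ltNge.
rewrite (eq_extended_gramian _ uU).
rewrite -(eq_extended_gramian _ (fun i => @gauge_rcons _ rho theta v _ u w i)).
have wU : w = U`_(m + m).+2 by rewrite nth_rcons size_tuple ltnn eqxx.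
rewrite [X in _ <-> X = _]wU.
rewrite (closure_orthogonal _ _ posU mp sp ortho) ?size_tuple //.
rewrite (closure_orthogonal (p := gauge_poly (Num.sqrt theta) v m p))
  ?size_tuple //.
- exact: closure_condition_gauge.
- by apply: moment_pos_gauge => //; lia.
- exact: gauge_poly_monic sp.
- by rewrite size_gauge_poly.
(* Orthogonality of the transformed polynomial: X^i pulls back to a multiple of (X + v)^i, still of
   degree below m. *)
move=> i im; rewrite moment_fun_gauge_poly //; last lia.
rewrite (orthogonal_to_lowerP ortho) ?mulr0 //.
by apply: (leq_trans (size_poly_exp_leq _ _)); rewrite size_XaddC; lia.
Qed.
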